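(* Consider a convex multiobjective optimization problem $\min (f_1(x),\dots,f_m(x))$ subject to $c_1(x)\ge 0,\dots,c_l(x)\ge 0$ in $x\in\mathbb{R}^n$, where all $f_j$ are convex real polynomials and all $c_i$ are concave real polynomials. Let $\mathcal{WP}$ be its weakly Pareto set. Suppose the matrix polynomial $C(x)$ (defined in the context) is nonsingular, i.e. $\operatorname{rank}C(x)=l$ for all $x\in\mathbb{C}^n$; let $C'(x)\in\mathbb{R}[x]^{l\times(n+l)}$ satisfy $C'(x)C(x)=I_l$, let $\ell_i(x)^T$ be the $i$th row of the submatrix formed by the first $n$ columns of $C'(x)$, and put $u_{ij}(x)=\ell_i(x)^T\nabla f_j(x)$. Suppose moreover that the $(n+l+1)\times m$ matrix polynomial $$P(x)=\begin{bmatrix}\sum_{i=1}^l u_{i1}(x)\nabla c_i(x)-\nabla f_1(x)&\cdots&\sum_{i=1}^l u_{im}(x)\nabla c_i(x)-\nabla f_m(x)\\ u_{11}(x)c_1(x)&\cdots&u_{1m}(x)c_1(x)\\ \vdots&&\vdots\\ u_{l1}(x)c_l(x)&\cdots&u_{lm}(x)c_l(x)\\ 1&\cdots&1\end{bmatrix}$$ is nonsingular, i.e. $\operatorname{rank}P(x)=m$ for all $x\in\mathbb{C}^n$, and let $P'(x)\in\mathbb{R}[x]^{m\times(n+l+1)}$ satisfy $P'(x)P(x)=I_m$. Put $$w(x)=(w_1(x),\dots,w_m(x))=P'(x)e_{n+l+1},\qquad \lambda_i(x)=\sum_{j=1}^m w_j(x)u_{ij}(x)\quad(i=1,\dots,l).$$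 Then $\mathcal{WP}$ equals the set of all $x\in\mathbb{R}^n$ such that $$\sum_{j=1}^m w_j(x)\nabla f_j(x)=\sum_{i=1}^l\lambda_i(x)\nabla c_i(x),$$ $$\lambda_i(x)\ge 0,\quad c_i(x)\ge 0,\quad \lambda_i(x)c_i(x)=0\quad(i=1,\dots,l),$$ $$w_1(x)\ge 0,\dots,w_m(x)\ge 0,\quad w_1(x)+\cdots+w_m(x)=1.$$
   Context: Let $K=\{x\in\mathbb{R}^n: c_1(x)\ge 0,\dots,c_l(x)\ge 0\}$. A point $x^*\in K$ is a weakly Pareto point if there is no $x\in K$ with $f_i(x)<f_i(x^* )$ for all $i=1,\dots,m$; the weakly Pareto set $\mathcal{WP}$ is the set of all weakly Pareto points. The matrix polynomial $C(x)$ is the $(n+l)\times l$ matrix whose top $n\times l$ block is $[\nabla c_1(x)\ \cdots\ \nabla c_l(x)]$ and whose bottom $l\times l$ block is $\operatorname{diag}(c_1(x),\dots,c_l(x))$. $e_{n+l+1}$ is the last standard unit vector of $\mathbb{R}^{n+l+1}$. Under the nonsingularity assumptions, matrix polynomials $C'(x)$ and $P'(x)$ with the stated properties exist. *)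

(* Defs.v *)
From HB Require Import structures.
From mathcomp Require Import all_boot all_order all_algebra.
From mathcomp Require Import mpoly complex.
From mathcomp Require Import boolp classical_sets reals.
(* convex is not imported: mathcomp-analysis notations clash with mpoly's. *)
From mathcomp Require convex.

Set Implicit Arguments.
Unset Strict Implicit.
Unset Printing Implicit Defensive.

Import Order.TTheory GRing.Theory Num.Theory.

Local Open Scope classical_set_scope.
Local Open Scope ring_scope.

Section Defs.
Variables (R : realType) (n : nat).
Implicit Types (p : {mpoly R[n]}) (x : 'cV[R]_n).

Definition peval p x : R := p.@[fun k => x k 0].

Definition pevalC p (z : 'cV[R[i]]_n) : R[i] :=
  (map_mpoly (real_complex R) p).@[fun k => z k 0].

Definition convex_mpoly p : Prop :=
  convex.convex_function [set: convex.convex_lmodType 'cV[R]_n] (peval p).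

Definition concave_mpoly p : Prop :=
  convex.convex_function [set: convex.convex_lmodType 'cV[R]_n]
    (fun x => - peval p x).

Definition grad p : 'cV[{mpoly R[n]}]_n := \col_k p^`M(k).

Definition grad_at p x : 'cV[R]_n := map_mx (fun q => peval q x) (grad p).

(* Full column rank at every complex point, not only at the real ones. *)
Definition nonsingular_mpmx (r s : nat) (A : 'M[{mpoly R[n]}]_(r, s)) : Prop :=
  forall z : 'cV[R[i]]_n, \rank (map_mx (fun q => pevalC q z) A) = s.

Definition feasible_set (l : nat) (c : 'I_l -> {mpoly R[n]}) : set 'cV[R]_n :=
  [set x | forall i, 0 <= peval (c i) x].

Definition weakly_pareto_set (m l : nat) (f : 'I_m -> {mpoly R[n]})
    (c : 'I_l -> {mpoly R[n]}) : set 'cV[R]_n :=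
  [set x | feasible_set c x /\
    ~ (exists y, feasible_set c y /\
         forall j, peval (f j) y < peval (f j) x)].

Definition constraint_mx (l : nat) (c : 'I_l -> {mpoly R[n]}) :
    'M[{mpoly R[n]}]_(n + l, l) :=
  col_mx (\matrix_(k, i) grad (c i) k 0) (diag_mx (\row_i c i)).

Section Multipliers.
Variables (m l : nat).
Variables (f : 'I_m -> {mpoly R[n]}) (c : 'I_l -> {mpoly R[n]}).
Variable C' : 'M[{mpoly R[n]}]_(l, n + l).

Definition u_poly (i : 'I_l) (j : 'I_m) : {mpoly R[n]} :=
  (row i (lsubmx C') *m grad (f j)) 0 0.

Definition pareto_mx : 'M[{mpoly R[n]}]_(n + l + 1, m) :=
  col_mx
    (col_mx
      (\matrix_(k, j)
         (\sum_(i < l) u_poly i j *: grad (c i) - grad (f j)) k 0)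
      (\matrix_(i, j) (u_poly i j * c i)))
    (const_mx 1).

Variable P' : 'M[{mpoly R[n]}]_(m, n + l + 1).

Definition w_poly (j : 'I_m) : {mpoly R[n]} :=
  (P' *m delta_mx (rshift (n + l) ord0) 0 : 'cV_m) j 0.

Definition lambda_poly (i : 'I_l) : {mpoly R[n]} :=
  \sum_(j < m) w_poly j * u_poly i j.

End Multipliers.
End Defs.

(* Main.v *)
Require Import Defs.
From HB Require Import structures.
From mathcomp Require Import all_boot all_order all_algebra.
From mathcomp Require Import mpoly complex.
From mathcomp Require Import boolp classical_sets reals.
From mathcomp Require Import functions interval_inference.
From mathcomp Require Import topology normedtype derive convex lra.

(* At a weakly Pareto point no direction decreases every [f j] and increases
   every active [c i] to first order, so Gordan's theorem of the alternative
   yields nonnegative Fritz John weights [w] and multipliers [y], not all zero.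
   Evaluating [C' C = 1] forces [y = U w], where [U] is the matrix of the
   [u_ij]; hence [w] is nonzero and can be normalised.  The Fritz John equations
   then say that [P(x) w] is the last unit vector, and [P' P = 1] gives
   [w = w(x)].  Conversely, convex polynomials lie above their tangents and
   concave ones below, which makes the conditions sufficient. *)

Set Implicit Arguments.
Unset Strict Implicit.
Unset Printing Implicit Defensive.

Import Order.TTheory GRing.Theory Num.Theory.
Import numFieldNormedType.Exports.

Local Open Scope classical_set_scope.
Local Open Scope ring_scope.

Section Gordan.
Variable R : realFieldType.

Lemma forall_col_mx p q (P : pred R) (u : 'cV[R]_p) (v : 'cV[R]_q) :
  (forall i, P (u i 0)) -> (forall i, P (v i 0)) ->
  forall i, P (col_mx u v i 0).
Proof. by move=> Pu Pv i; rewrite mxE; case: splitP. Qed.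

Lemma trmx_mul_self_gt0 n (a : 'cV[R]_n) : a != 0 -> 0 < (a^T *m a) 0 0.
Proof.
move=> a_neq0; rewrite mxE; under eq_bigr do rewrite mxE -expr2.
rewrite lt_def sumr_ge0 => [|k _]; last exact: sqr_ge0.
rewrite andbT; apply: contraNneq a_neq0 => /psumr_eq0P sqr_a0.
apply/eqP/colP => k; rewrite mxE; apply/eqP; rewrite -sqrf_eq0.
by rewrite sqr_a0 // => i _; exact: sqr_ge0.
Qed.

Lemma near_right_perturbation_gt0 p (u v : 'cV[R]_p) :
  (forall i, 0 < u i 0) ->
  \forall t \near (0 : R)^'+, forall i, 0 < (u + t *: v) i 0.
Proof.
move=> u_gt0; apply: filter_forall => i.
apply: (cvgr_gt (u i 0)) => //; apply: cvg_at_right_filter.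
under eq_fun do rewrite mxE [X in _ + X]mxE.
suff : u i 0 + t * v i 0 @[t --> (0 : R)] --> u i 0 + 0 * v i 0.
  by rewrite mul0r addr0.
by apply: cvgD; [exact: cvg_cst|apply: cvgMl; exact: cvg_id].
Qed.

Section NewColumn.
Variables (n p : nat) (a : 'cV[R]_n) (B : 'M[R]_(n, p)).

Lemma row_mx_direction_gt0 (d : 'cV[R]_n) :
  a != 0 -> 0 <= (a^T *m d) 0 0 -> (forall i, 0 < (B^T *m d) i 0) ->
  exists e : 'cV[R]_n, forall i, 0 < ((row_mx a B)^T *m e) i 0.
Proof.
move=> a_neq0 ad_ge0 Bd_gt0.
near (0 : R)^'+ => t; have t_gt0 : 0 < t by [].
have Bt_gt0 : forall i, 0 < (B^T *m d + t *: (B^T *m a)) i 0.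
  by near: t; exact: near_right_perturbation_gt0.
exists (d + t *: a); rewrite tr_row_mx mul_col_mx.
rewrite [a^T *m _]mulmxDr [B^T *m _]mulmxDr -!scalemxAr.
apply: forall_col_mx => // i; rewrite (ord1 i) mxE [X in _ + X]mxE.
by rewrite ltr_wpDl // mulr_gt0 // trmx_mul_self_gt0.
Unshelve. all: by end_near. Qed.

(* Sheared along [a], the columns of [B] become orthogonal to [d], so moving a
   solution along [d] until it is orthogonal to [a] keeps their inequalities. *)
Definition shear_mx (d : 'cV[R]_n) : 'M[R]_(n, p) :=
  B - ((a^T *m d) 0 0)^-1 *: (a *m (d^T *m B)).

Lemma shear_mx_direction_gt0 (d e : 'cV[R]_n) :
  (a^T *m d) 0 0 != 0 -> a != 0 -> (forall i, 0 < ((shear_mx d)^T *m e) i 0) ->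
  exists e' : 'cV[R]_n, forall i, 0 < ((row_mx a B)^T *m e') i 0.
Proof.
set alpha := (a^T *m d) 0 0 => alpha_neq0 a_neq0 se_gt0.
pose e' := e - alpha^-1 *: (d *m (a^T *m e)).
have ae'0 : a^T *m e' = 0.
  rewrite mulmxBr -scalemxAr !mulmxA [a^T *m d]mx11_scalar.
  rewrite mul_scalar_mx -scalemxAl scalerA.
  by rewrite mulVf // scale1r subrr.
have Be' : B^T *m e' = (shear_mx d)^T *m e.
  rewrite /shear_mx -/alpha [(B - _)^T]linearB linearZ /= !trmx_mul trmxK.
  by rewrite mulmxBl mulmxBr -scalemxAr -scalemxAl !mulmxA.
by apply: (@row_mx_direction_gt0 e'); rewrite ?Be' // ae'0 mxE.
Qed.

Lemma shear_mx_kernel_ge0 (d : 'cV[R]_n) (y : 'cV[R]_p) :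
  (a^T *m d) 0 0 < 0 -> (forall i, 0 < (B^T *m d) i 0) ->
  (forall i, 0 <= y i 0) -> shear_mx d *m y = 0 ->
  exists2 z : 'cV[R]_1, 0 <= z 0 0 & row_mx a B *m col_mx z y = 0.
Proof.
move=> ad_lt0 Bd_gt0 y_ge0 sy0.
exists (- ((a^T *m d) 0 0)^-1 *: (d^T *m B *m y)).
  rewrite mxE mulr_ge0 //; first by rewrite oppr_ge0 invr_le0 ltW.
  rewrite mxE sumr_ge0 // => i _; rewrite mulr_ge0 //.
  by rewrite -[B]trmxK -trmx_mul mxE ltW.
rewrite mul_row_col -[RHS]sy0 /shear_mx mulmxBl addrC -scalemxAr -scalemxAl.
by rewrite scaleNr !mulmxA.
Qed.

End NewColumn.

Theorem gordan n p (G : 'M[R]_(n, p)) :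
  (exists d : 'cV[R]_n, forall i, 0 < (G^T *m d) i 0) \/
  (exists y : 'cV[R]_p, [/\ forall i, 0 <= y i 0, y != 0 & G *m y = 0]).
Proof.
elim: p G => [G|p IHp]; first by left; exists 0; case.
rewrite -[p.+1]add1n => G; rewrite -[G]hsubmxK.
move: (lsubmx _) (rsubmx _) => a B.
have [->|a_neq0] := eqVneq a 0.
  right; exists (col_mx 1 0); split.
  - by apply: forall_col_mx => i; rewrite ?ord1 mxE ?ler01.
  - by rewrite col_mx_eq0 oner_eq0.
  - by rewrite mul_row_col mul0mx mulmx0 addr0.
have [[d Bd_gt0]|[y [y_ge0 y_neq0 By0]]] := IHp B; last first.
  right; exists (col_mx 0 y); split.
  - by apply: forall_col_mx => // i; rewrite mxE.
  - by rewrite col_mx_eq0 negb_and y_neq0 orbT.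
  - by rewrite mul_row_col mulmx0 By0 addr0.
have [ad_ge0|ad_lt0] := lerP 0 ((a^T *m d) 0 0).
  by left; apply: row_mx_direction_gt0 ad_ge0 Bd_gt0.
have [[e se_gt0]|[y [y_ge0 y_neq0 sy0]]] := IHp (shear_mx a B d).
  by left; apply: shear_mx_direction_gt0 se_gt0; rewrite // lt_eqF.
have [z z_ge0 zy0] := shear_mx_kernel_ge0 ad_lt0 Bd_gt0 y_ge0 sy0.
right; exists (col_mx z y); split=> //.
- by apply: forall_col_mx => // i; rewrite ord1.
- by rewrite col_mx_eq0 negb_and y_neq0 orbT.
Qed.

End Gordan.

Section DirectionalDerivative.
Variables (R : realFieldType) (V : normedModType R).
Implicit Types (f : V -> R) (x y d : V).

Lemma is_derive_cvg_right f x d l : is_derive x d f l ->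
  t^-1 * (f (x + t *: d) - f x) @[t --> (0 : R)^'+] --> l.
Proof.
move=> [fd <-]; apply: cvg_dnbhs_at_right.
by under eq_fun do rewrite [x + _]addrC; exact: fd.
Qed.

Lemma is_derive_near_right_lt f x d l : is_derive x d f l -> 0 < l ->
  \forall t \near (0 : R)^'+, f x < f (x + t *: d).
Proof.
move=> /is_derive_cvg_right fl l_gt0; near=> t; have t_gt0 : 0 < t by [].
rewrite -subr_gt0 -(pmulr_rgt0 _ (_ : 0 < t^-1)) ?invr_gt0 //.
by near: t; exact: cvgr_gt fl _ l_gt0.
Unshelve. all: by end_near. Qed.

Lemma is_derive_near_right_gt0 f x d l : is_derive x d f l -> 0 < f x ->
  \forall t \near (0 : R)^'+, 0 < f (x + t *: d).
Proof.
move=> [/derivable1P/derivable1_diffP/differentiable_continuous f_cont _].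
move=> fx_gt0.
have f_cvg : f (x + t *: d) @[t --> (0 : R)^'+] --> f x.
  apply: cvg_at_right_filter; under eq_fun do rewrite [x + _]addrC.
  by move: f_cont; rewrite /prop_for /continuous_at /= scale0r add0r.
exact: cvgr_gt f_cvg _ fx_gt0.
Qed.

Lemma convex_function_ge_tangent f x y l :
  convex_function [set: convex_lmodType V] f -> is_derive x (y - x) f l ->
  l <= f y - f x.
Proof.
move=> f_convex /is_derive_cvg_right fl.
apply: (cvgr_to_le fl); near=> t.
have t_gt0 : 0 < t by [].
have t_le1 : t <= 1 by near: t; exact: nbhs_right_le ltr01.
rewrite ler_pdivrMl //.
have : f (t *: y + (1 - t) *: x) <= t * f y + (1 - t) * f x.
  exact: f_convex (Itv01 (ltW t_gt0) t_le1) y x (in_setT _) (in_setT _).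
have -> : t *: y + (1 - t) *: x = x + t *: (y - x).
  by rewrite scalerBl scale1r scalerBr addrCA.
lra.
Unshelve. all: by end_near. Qed.

End DirectionalDerivative.

Lemma is_derive_coord (R : numFieldType) (m n : nat) (i : 'I_m) (j : 'I_n)
    (x d : 'M[R]_(m, n)) :
  is_derive x d (fun y : 'M[R]_(m, n) => y i j) (d i j).
Proof.
have quotient_cst : \forall h \near (0 : R)^',
    h^-1 *: ((h *: d + x) i j - x i j) = d i j.
  near=> h; rewrite !mxE addrK /GRing.scale /= mulKf //.
  by near: h; exact: nbhs_dnbhs_neq.
apply: DeriveDef; first exact: is_cvg_near_cst quotient_cst.
exact: lim_near_cst quotient_cst.
Unshelve. all: by end_near. Qed.

Lemma mpoly_ring_ind (R : nzRingType) (n : nat) (P : {mpoly R[n]} -> Prop) :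
  (forall a, P a%:MP) -> (forall k, P 'X_k) ->
  (forall p q, P p -> P q -> P (p + q)) ->
  (forall p q, P p -> P q -> P (p * q)) -> forall p, P p.
Proof.
move=> PC PX PD PM; elim/mpolyind=> [|a m p _ _ Pp]; first by rewrite -mpolyC0.
apply: PD => //; rewrite -mul_mpolyC mpolyXE_id; apply: (PM _ _ (PC a)).
apply: (big_ind P) => [||k _]; [by rewrite -mpolyC1|exact: PM|].
elim: (m k) => [|e IHe]; first by rewrite expr0 -mpolyC1.
by rewrite exprS; apply: PM.
Qed.

Section Polynomials.
Variables (R : realType) (n : nat).
Implicit Types (p q : {mpoly R[n]}) (x d : 'cV[R]_n).

Lemma grad_atC (a : R) x : grad_at (a%:MP : {mpoly R[n]}) x = 0.
Proof. by apply/colP => k; rewrite !mxE mderivC /peval meval0. Qed.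

Lemma grad_atX k x : grad_at ('X_k : {mpoly R[n]}) x = delta_mx k 0.
Proof.
apply/colP => j; rewrite !mxE mderivX mnm1E eqxx andbT /peval mevalZ eq_sym.
case: eqP => [->|_]; rewrite ?mul0r // mul1r.
have -> : (U_(k) - U_(k) = 0)%MM by apply/mnmP => i; rewrite !mnmE subnn.
by rewrite mpolyX0 meval1.
Qed.

Lemma grad_atD p q x : grad_at (p + q) x = grad_at p x + grad_at q x.
Proof. by apply/colP => k; rewrite !mxE mderivD /peval mevalD. Qed.

Lemma grad_atM p q x :
  grad_at (p * q) x = peval p x *: grad_at q x + peval q x *: grad_at p x.
Proof.
apply/colP => k; rewrite !mxE mderivM /peval mevalD !mevalM addrC.
by congr (_ + _); exact: mulrC.
Qed.

Definition dir_deriv p x d : R := ((grad_at p x)^T *m d) 0 0.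

Lemma is_derive_peval p x d : is_derive x d (peval p) (dir_deriv p x d).
Proof.
rewrite /dir_deriv; elim/mpoly_ring_ind: p => [a|k|p q dp dq|p q dp dq].
- have -> : peval (a%:MP : {mpoly R[n]}) = cst a
    by apply/funext => y; rewrite /peval mevalC.
  by rewrite grad_atC trmx0 mul0mx mxE; exact: is_derive_cst.
- have -> : peval 'X_k = (fun y : 'cV[R]_n => y k 0).
    by apply/funext => y; rewrite /peval mevalXU.
  by rewrite grad_atX trmx_delta -rowE mxE; exact: is_derive_coord.
- have -> : peval (p + q) = peval p + peval q.
    by apply/funext => y; rewrite /peval mevalD.
  by rewrite grad_atD linearD mulmxDl mxE; exact: is_deriveD.
- have -> : peval (p * q) = peval p * peval q.
    by apply/funext => y; rewrite /peval mevalM.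
  rewrite grad_atM linearD !linearZ mulmxDl -!scalemxAl mxE.
  rewrite [X in X + _]mxE [X in _ + X]mxE.
  exact: is_deriveM.
Qed.

Lemma peval_near_right_gt0 p x d : 0 < peval p x ->
  \forall t \near (0 : R)^'+, 0 < peval p (x + t *: d).
Proof. exact: is_derive_near_right_gt0 (is_derive_peval p x d). Qed.

Lemma peval_near_right_lt p x d : 0 < dir_deriv p x d ->
  \forall t \near (0 : R)^'+, peval p x < peval p (x + t *: d).
Proof. exact: is_derive_near_right_lt (is_derive_peval p x d). Qed.

Lemma peval_near_right_gt p x d : dir_deriv p x d < 0 ->
  \forall t \near (0 : R)^'+, peval p (x + t *: d) < peval p x.
Proof.
rewrite -oppr_gt0.
move=> /(is_derive_near_right_lt (is_deriveN (is_derive_peval p x d))).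
by apply: filterS => t /=; rewrite ltrN2.
Qed.

Lemma convex_mpoly_ge_tangent p x y : convex_mpoly p ->
  dir_deriv p x (y - x) <= peval p y - peval p x.
Proof. by move/convex_function_ge_tangent; apply; exact: is_derive_peval. Qed.

Lemma concave_mpoly_le_tangent p x y : concave_mpoly p ->
  peval p y - peval p x <= dir_deriv p x (y - x).
Proof.
move=> p_concave.
have := convex_function_ge_tangent p_concave
  (is_deriveN (is_derive_peval p x (y - x))).
lra.
Qed.

End Polynomials.

Lemma nonneg_sum_mul_gt0 (R : realDomainType) (p : nat) (w : 'cV[R]_p)
    (a : 'I_p -> R) :
  (forall j, 0 <= w j 0) -> w != 0 -> (forall j, 0 < a j) ->
  0 < \sum_j w j 0 * a j.
Proof.
move=> w_ge0 w_neq0 a_gt0.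
have wa_ge0 j : true -> 0 <= w j 0 * a j by rewrite mulr_ge0 // ltW.
rewrite lt_def sumr_ge0 // andbT; apply: contraNneq w_neq0 => sum0.
apply/eqP/colP => j; rewrite mxE; apply/eqP.
have /eqP := psumr_eq0P wa_ge0 sum0 (i := j) isT.
by rewrite mulf_eq0 (gt_eqF (a_gt0 j)) orbF.
Qed.

Section GradientMatrix.
Variables (R : realType) (n r : nat) (g : 'I_r -> {mpoly R[n]}).
Implicit Types (x d : 'cV[R]_n) (u : 'cV[R]_r).

Definition grad_mx x : 'M[R]_(n, r) := \matrix_(k, j) grad_at (g j) x k 0.

Lemma mul_grad_mx_col x (a : 'I_r -> R) :
  grad_mx x *m (\col_j a j) = \sum_j a j *: grad_at (g j) x.
Proof.
apply/colP => k; rewrite mxE summxE; apply: eq_bigr => j _.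
by rewrite !mxE mulrC.
Qed.

Lemma tr_grad_mx_mul x d j :
  ((grad_mx x)^T *m d) j 0 = dir_deriv (g j) x d.
Proof. by rewrite /dir_deriv !mxE; apply: eq_bigr => k _; rewrite !mxE. Qed.

Lemma tr_mul_grad_mx x u d :
  ((grad_mx x *m u)^T *m d) 0 0 = \sum_j u j 0 * dir_deriv (g j) x d.
Proof.
rewrite trmx_mul -mulmxA mxE; apply: eq_bigr => j _.
by rewrite tr_grad_mx_mul mxE.
Qed.

End GradientMatrix.

Section FritzJohn.
Variables (R : realType) (n m l : nat).
Variables (f : 'I_m -> {mpoly R[n]}) (c : 'I_l -> {mpoly R[n]}).
Implicit Types (x d : 'cV[R]_n) (w : 'cV[R]_m) (y : 'cV[R]_l).

Definition fritz_john x w y : Prop :=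
  [/\ forall j, 0 <= w j 0, forall i, 0 <= y i 0,
      forall i, y i 0 * peval (c i) x = 0
    & grad_mx f x *m w = grad_mx c x *m y].

Lemma fritz_john_complementarity x w y :
  fritz_john x w y -> \col_i (y i 0 * peval (c i) x) = 0.
Proof. by case=> _ _ yc0 _; apply/colP => i; rewrite !mxE yc0. Qed.

Lemma fritz_johnZ (t : R) x w y :
  0 <= t -> fritz_john x w y -> fritz_john x (t *: w) (t *: y).
Proof.
move=> t_ge0 [w_ge0 y_ge0 yc0 stationary]; split=> [j|i|i|].
- by rewrite mxE mulr_ge0.
- by rewrite mxE mulr_ge0.
- by rewrite mxE -mulrA yc0 mulr0.
- by rewrite -!scalemxAr stationary.
Qed.

Definition kkt x w y : Prop :=
  [/\ feasible_set c x, fritz_john x w y & \sum_j w j 0 = 1].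

Lemma kktP x (w : 'I_m -> R) (y : 'I_l -> R) :
  kkt x (\col_j w j) (\col_i y i) <->
  [/\ \sum_j w j *: grad_at (f j) x = \sum_i y i *: grad_at (c i) x,
      forall i, [/\ 0 <= y i, 0 <= peval (c i) x & y i * peval (c i) x = 0],
      forall j, 0 <= w j
    & \sum_j w j = 1].
Proof.
rewrite /kkt /fritz_john !mul_grad_mx_col.
have -> : \sum_j (\col_j w j) j 0 = \sum_j w j.
  by apply: eq_bigr => j _; rewrite mxE.
split=> [[x_feasible [w_ge0 y_ge0 yc0 stationary] sum_w]|].
  split=> // [i|j]; last by have := w_ge0 j; rewrite mxE.
  by have := y_ge0 i; have := yc0 i; rewrite mxE.
case=> stationary yc w_ge0 sum_w; split=> // [i|]; first by have [] := yc i.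
by split=> // i; rewrite mxE //; have [] := yc i.
Qed.

Lemma weakly_pareto_no_descent x d :
  weakly_pareto_set f c x -> (forall j, dir_deriv (f j) x d < 0) ->
  ~ (forall i, peval (c i) x = 0 -> 0 < dir_deriv (c i) x d).
Proof.
move=> [x_feasible x_optimal] fd_lt0 cd_gt0; apply: x_optimal.
near (0 : R)^'+ => t; exists (x + t *: d); split; near: t.
  apply: filter_forall => i.
  have := x_feasible i; rewrite le_eqVlt => /predU1P[ci0|ci_gt0].
    apply: filterS (peval_near_right_lt (cd_gt0 i (esym ci0))) => t.
    by rewrite -ci0 => /ltW.
  by apply: filterS (peval_near_right_gt0 d ci_gt0) => t /ltW.
by apply: filter_forall => j; exact: peval_near_right_gt.
Unshelve. all: by end_near. Qed.

(* Appending the row of the values [peval (c i) x] to the gradients lets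
   Gordan's alternative enforce complementarity: in a direction [col_mx d s]
   the slack [s] is only helpful for the inactive constraints. *)
Lemma weakly_pareto_fritz_john x : weakly_pareto_set f c x ->
  exists w y, fritz_john x w y /\ col_mx w y != 0.
Proof.
move=> wpx; have [x_feasible _] := wpx.
pose cx : 'rV[R]_l := \row_i peval (c i) x.
have [[e]|[z]] := gordan
    (col_mx (row_mx (- grad_mx f x) (grad_mx c x)) (row_mx 0 cx)).
  rewrite -[e]vsubmxK; move: (usubmx e) (dsubmx e) => d s.
  rewrite tr_col_mx !tr_row_mx mul_row_col !mul_col_mx add_col_mx trmx0 mul0mx.
  rewrite addr0 => ds_gt0.
  case: (weakly_pareto_no_descent (d := d) wpx) => [j|i ci0].
    have := ds_gt0 (lshift l j).
    by rewrite col_mxEu linearN mulNmx mxE tr_grad_mx_mul oppr_gt0.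
  have := ds_gt0 (rshift m i).
  rewrite col_mxEd mxE tr_grad_mx_mul [X in _ + X]mxE big_ord1 !mxE ci0.
  by rewrite mul0r addr0.
rewrite -[z]vsubmxK; move: (usubmx z) (dsubmx z) => w y.
rewrite mul_col_mx !mul_row_col mul0mx add0r => -[wy_ge0 wy_neq0 /eqP].
rewrite col_mx_eq0 => /andP[/eqP stationary /eqP cy0].
have y_ge0 i : 0 <= y i 0 by have := wy_ge0 (rshift m i); rewrite col_mxEd.
exists w, y; split=> //; split=> // [j|i|].
- by have := wy_ge0 (lshift l j); rewrite col_mxEu.
- have cy_ge0 k : true -> 0 <= cx 0 k * y k 0.
    by rewrite mulr_ge0 // mxE x_feasible.
  have sum0 : \sum_k cx 0 k * y k 0 = 0.
    by move/matrixP: cy0 => /(_ 0 0); rewrite !mxE.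
  by have := psumr_eq0P cy_ge0 sum0 (i := i) isT; rewrite mxE mulrC.
- by apply/eqP; rewrite eq_sym -subr_eq0 addrC -mulNmx stationary.
Qed.

Lemma fritz_john_weakly_pareto x w y :
  (forall j, convex_mpoly (f j)) -> (forall i, concave_mpoly (c i)) ->
  feasible_set c x -> fritz_john x w y -> w != 0 -> weakly_pareto_set f c x.
Proof.
move=> f_convex c_concave x_feasible [w_ge0 y_ge0 yc0 stationary] w_neq0.
split=> // -[z [z_feasible fz_lt]].
have c_ge0 : 0 <= \sum_i y i 0 * dir_deriv (c i) x (z - x).
  apply: sumr_ge0 => i _.
  apply: (@le_trans _ _ (y i 0 * (peval (c i) z - peval (c i) x))).
    by rewrite mulrBr yc0 subr0 mulr_ge0.
  by rewrite ler_wpM2l // concave_mpoly_le_tangent.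
have f_gt0 : 0 < \sum_j w j 0 * - dir_deriv (f j) x (z - x).
  apply: nonneg_sum_mul_gt0 => // j; rewrite oppr_gt0.
  apply: le_lt_trans (convex_mpoly_ge_tangent x z (f_convex j)) _.
  by rewrite subr_lt0.
move: c_ge0; rewrite -tr_mul_grad_mx -stationary tr_mul_grad_mx leNgt.
by rewrite -oppr_gt0 -sumrN; under eq_bigr do rewrite -mulrN; rewrite f_gt0.
Qed.

End FritzJohn.

Lemma map_mx_mulKmx (aR rR : pzRingType) (h : {rmorphism aR -> rR})
    (p q r : nat) (A : 'M[aR]_(p, q)) (B : 'M[aR]_(q, p)) (v : 'M[rR]_(p, r)) :
  A *m B = 1%:M -> map_mx h A *m (map_mx h B *m v) = v.
Proof. by move=> AB1; rewrite mulmxA -map_mxM AB1 map_mx1 mul1mx. Qed.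

Section PolynomialMultipliers.
Variables (R : realType) (n m l : nat).
Variables (f : 'I_m -> {mpoly R[n]}) (c : 'I_l -> {mpoly R[n]}).
Variable C' : 'M[{mpoly R[n]}]_(l, n + l).
Hypothesis C'C : C' *m constraint_mx c = 1%:M.
Implicit Types (x : 'cV[R]_n) (w : 'cV[R]_m) (y : 'cV[R]_l).

Local Notation evalmx x := (map_mx (meval (fun k => (x : 'cV[R]_n) k 0))).

Definition u_mx x : 'M[R]_(l, m) := \matrix_(i, j) peval (u_poly f C' i j) x.

Lemma u_mxE x : u_mx x = evalmx x (lsubmx C') *m grad_mx f x.
Proof.
apply/matrixP => i j; rewrite mxE /u_poly /peval !mxE rmorph_sum.
by apply: eq_bigr => k _ /=; rewrite !mxE rmorphM.
Qed.

Lemma mul_constraint_mx x y : evalmx x (constraint_mx c) *m y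
  = col_mx (grad_mx c x *m y) (\col_i (y i 0 * peval (c i) x)).
Proof.
rewrite map_col_mx mul_col_mx map_diag_mx mul_diag_mx; congr col_mx.
  by congr (_ *m _); apply/matrixP => k i; rewrite !mxE.
by apply/colP => i; rewrite !mxE mulrC.
Qed.

Lemma fritz_john_multipliers x w y :
  fritz_john f c x w y -> y = u_mx x *m w.
Proof.
move=> fj; have [_ _ _ stationary] := fj.
rewrite -[LHS](map_mx_mulKmx (meval (fun k => x k 0)) y C'C) mul_constraint_mx.
rewrite (fritz_john_complementarity fj) -stationary -[C' in LHS]hsubmxK.
by rewrite map_row_mx mul_row_col mulmx0 addr0 u_mxE mulmxA.
Qed.

Lemma fritz_john_weights_neq0 x w y :
  fritz_john f c x w y -> col_mx w y != 0 -> w != 0.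
Proof.
move=> fj; rewrite (fritz_john_multipliers fj).
by apply: contraNneq => ->; rewrite mulmx0 col_mx0.
Qed.

Lemma weakly_pareto_kkt x :
  weakly_pareto_set f c x -> exists w y, kkt f c x w y.
Proof.
move=> wpx; have [w [y [fj wy_neq0]]] := weakly_pareto_fritz_john wpx.
have w_neq0 := fritz_john_weights_neq0 fj wy_neq0; have [w_ge0 _ _ _] := fj.
have sum_gt0 : 0 < \sum_j w j 0.
  by under eq_bigr do rewrite -[w _ _]mulr1; exact: nonneg_sum_mul_gt0.
exists ((\sum_j w j 0)^-1 *: w), ((\sum_j w j 0)^-1 *: y); split.
- by case: wpx.
- by apply: fritz_johnZ; rewrite // invr_ge0 ltW.
- by under eq_bigr do rewrite mxE; rewrite -mulr_sumr mulVf // gt_eqF.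
Qed.

Lemma mul_pareto_mx x w : evalmx x (pareto_mx f c C') *m w
  = col_mx (col_mx (grad_mx c x *m (u_mx x *m w) - grad_mx f x *m w)
                   (\col_i ((u_mx x *m w) i 0 * peval (c i) x)))
           (const_mx (\sum_j w j 0)).
Proof.
rewrite !map_col_mx !mul_col_mx; congr (col_mx (col_mx _ _) _).
- rewrite mulmxA -mulmxBl; congr (_ *m _); apply/matrixP => k j.
  rewrite !mxE summxE rmorphB rmorph_sum; congr (_ - _).
  by apply: eq_bigr => i _; rewrite !mxE rmorphM mulrC.
- apply/colP => i; rewrite !mxE mulr_suml; apply: eq_bigr => j _.
  by rewrite !mxE rmorphM mulrAC.
- apply/colP => k; rewrite !mxE; apply: eq_bigr => j _.
  by rewrite !mxE meval1 mul1r.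
Qed.

Variable P' : 'M[{mpoly R[n]}]_(m, n + l + 1).
Hypothesis P'P : P' *m pareto_mx f c C' = 1%:M.

Definition weights x : 'cV[R]_m := \col_j peval (w_poly P' j) x.

Definition multipliers x : 'cV[R]_l := \col_i peval (lambda_poly f C' P' i) x.

Lemma weightsE x : weights x = evalmx x P' *m col_mx 0 (const_mx 1).
Proof.
have -> : const_mx 1 = delta_mx 0 0 :> 'M[R]_1.
  by apply/matrixP => i j; rewrite !mxE !ord1 eqxx.
rewrite -delta_mx_dshift -(map_delta_mx (meval (fun k => x k 0))) -map_mxM.
by apply/colP => j; rewrite mxE [RHS]mxE.
Qed.

Lemma multipliersE x : multipliers x = u_mx x *m weights x.
Proof.
apply/colP => i; rewrite !mxE /peval rmorph_sum; apply: eq_bigr => j _ /=.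
by rewrite !mxE rmorphM mulrC.
Qed.

Lemma kkt_weights x w y : kkt f c x w y -> w = weights x.
Proof.
case=> _ fj sum_w; have [_ _ _ stationary] := fj.
rewrite -[LHS](map_mx_mulKmx (meval (fun k => x k 0)) w P'P) mul_pareto_mx.
rewrite -(fritz_john_multipliers fj) (fritz_john_complementarity fj).
by rewrite stationary subrr sum_w col_mx0 weightsE.
Qed.

Lemma weakly_pareto_kktP x :
  (forall j, convex_mpoly (f j)) -> (forall i, concave_mpoly (c i)) ->
  weakly_pareto_set f c x <-> kkt f c x (weights x) (multipliers x).
Proof.
move=> f_convex c_concave; split=> [/weakly_pareto_kkt[w [y kkt_wy]]|].
  have [_ fj _] := kkt_wy.
  by rewrite multipliersE -(kkt_weights kkt_wy) -(fritz_john_multipliers fj).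
case=> x_feasible fj sum_w; apply: fritz_john_weakly_pareto fj _ => //.
apply: contra_eq_neq sum_w => ->; under eq_bigr do rewrite mxE.
by rewrite big1 // eq_sym oner_eq0.
Qed.

End PolynomialMultipliers.

Theorem mainTheorem3 (R : realType) (n m l : nat)
    (f : 'I_m -> {mpoly R[n]}) (c : 'I_l -> {mpoly R[n]})
    (f_convex : forall j, convex_mpoly (f j))
    (c_concave : forall i, concave_mpoly (c i))
    (C_nonsingular : nonsingular_mpmx (constraint_mx c))
    (C' : 'M[{mpoly R[n]}]_(l, n + l))
    (C'C : C' *m constraint_mx c = 1%:M)
    (P_nonsingular : nonsingular_mpmx (pareto_mx f c C'))
    (P' : 'M[{mpoly R[n]}]_(m, n + l + 1))
    (P'P : P' *m pareto_mx f c C' = 1%:M) :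
  let w j x := peval (w_poly P' j) x in
  let lambda i x := peval (lambda_poly f C' P' i) x in
  weakly_pareto_set f c =
  [set x : 'cV[R]_n |
    [/\ \sum_(j < m) w j x *: grad_at (f j) x
          = \sum_(i < l) lambda i x *: grad_at (c i) x,
        forall i, [/\ 0 <= lambda i x, 0 <= peval (c i) x
                    & lambda i x * peval (c i) x = 0],
        forall j, 0 <= w j x
      & \sum_(j < m) w j x = 1]].
Proof.
move=> w lambda; apply/seteqP; split=> x.
  by move/(weakly_pareto_kktP C'C P'P x f_convex c_concave)/kktP.
by move/kktP/(weakly_pareto_kktP C'C P'P x f_convex c_concave).
Qed.
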